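(* Let $(M,g)$ be a Riemannian manifold with $\dim M\ge 2$, let $G$ be a nondegenerate $g$-natural metric on the tangent bundle $TM$, let $x\in M$ and let $X\in T_xM$ be a unit vector, $g(X,X)=1$. If $\lambda$ is an eigenvalue of the Jacobi operator $J_X$ of $(M,g)$, then $\lambda$ is an eigenvalue of the Jacobi operator $\bar J_{X^h_{(x,0_x)}}$ of $(TM,G)$ at the point $(x,0_x)\in TM$, where $X^h_{(x,0_x)}$ is the horizontal lift of $X$ to $(x,0_x)$.
   Context: Lifts: the Levi-Civita connection $\nabla$ of $g$ splits $T_{(x,u)}TM=H_{(x,u)}\oplus V_{(x,u)}$ into horizontal and vertical subspaces. For $X\in T_xM$, $X^h_{(x,u)}$ and $X^v_{(x,u)}$ denote the horizontal and vertical lifts of $X$ to $(x,u)$. $g$-natural metrics: a $g$-natural metric on $TM$ is a symmetric $(0,2)$-tensor field $G$ on $TM$ for which there are smooth functions $\alpha_i,\beta_i:[0,\infty)\to\mathbb R$, $i=1,2,3$, such that for all $x\in M$, $u,X,Y\in T_xM$, with $t=g(u,u)$ (lifts taken at $(x,u)$): $G(X^h,Y^h)=(\alpha_1+\alpha_3)(t)g(X,Y)+(\beta_1+\beta_3)(t)g(X,u)g(Y,u)$; $G(X^h,Y^v)=G(X^v,Y^h)=\alpha_2(t)g(X,Y)+\beta_2(t)g(X,u)g(Y,u)$; $G(X^v,Y^v)=\alpha_1(t)g(X,Y)+\beta_1(t)g(X,u)g(Y,u)$. ''Nondegenerate'' means that $G$ is nondegenerate at every point of $TM$, so $G$ is a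 pseudo-Riemannian metric. Jacobi operators: if $(N,h)$ is a (pseudo-)Riemannian manifold with curvature operator $R$ and $X\in T_pN$, then $J_X:T_pN\to T_pN$ is $J_X(Y)=R(X,Y)X$. The same sign convention for the curvature is used for $(M,g)$ and $(TM,G)$; the Jacobi operators of $(TM,G)$ are written $\bar J$. *)

(* Defs.v *)
From HB Require Import structures.
From mathcomp Require Import all_boot all_order all_algebra.
From mathcomp Require Import all_classical all_reals all_analysis.

Set Implicit Arguments.
Unset Strict Implicit.
Unset Printing Implicit Defensive.

Import Order.TTheory GRing.Theory Num.Theory.
Import numFieldNormedType.Exports.
Local Open Scope classical_set_scope.
Local Open Scope ring_scope.

Section Smooth.
Variable R : realType.
Implicit Types V W : normedModType R.

Fixpoint Ck V W (k : nat) (U : set V) (f : V -> W) : Prop :=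
  if k is k'.+1 then
    (forall x, U x -> differentiable f x) /\ (forall v, Ck k' U ('D_v f))
  else forall x, U x -> {for x, continuous f}.

(* Meaningful when [U] is open. *)
Definition smooth V W (U : set V) (f : V -> W) : Prop := forall k, Ck k U f.

(* Smooth on [0, +oo[: restriction of a smooth function on the real line. *)
Definition smooth_nonneg (a : R -> R) : Prop :=
  exists2 b : R -> R, smooth setT b & forall t, 0 <= t -> a t = b t.

Lemma near_eq_differentiable V W (f g : V -> W) a :
  (\near a, f a = g a) -> differentiable f a -> differentiable g a.
Proof.
move=> fg df; have [cdf /eqaddoP fo] := (diff_locallyP _ _).1 df.
have go : g \o shift a = cst (g a) + 'd f a +o_ 0 id.
  apply/eqaddoP => e e0; have := fo e e0.
  have fg' : \forall h \near (0 : V), f (h + a) = g (h + a).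
    move: fg; rewrite (near_shift 0) subr0 => ?.
    near=> h; near: h. exact.
  move=> H; near=> h.
  have -> : (g \o shift a - (cst (g a) + 'd f a)) h =
            (f \o shift a - (cst (f a) + 'd f a)) h.
    rewrite /= !fctE /= -(nbhs_singleton fg); congr (_ - _).
    by symmetry; near: h.
  by near: h.
apply/diff_locallyP; have E := diff_unique cdf go.
by rewrite E; split.
Unshelve. all: by end_near. Qed.

Lemma open_near_eq V W (U : set V) (f g : V -> W) x : open U ->
  (forall y, U y -> f y = g y) -> U x -> \forall y \near x, f y = g y.
Proof.
move=> oU fg Ux; near=> y; apply: fg; near: y.
by apply: open_nbhs_nbhs; split.
Unshelve. all: by end_near. Qed.

Lemma Ck_eq V W k (U : set V) (f g : V -> W) : open U ->
  (forall x, U x -> f x = g x) -> Ck k U f -> Ck k U g.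
Proof.
move=> oU; elim: k f g => [|k IH] f g fg /=.
  move=> cf x Ux; have := cf x Ux; rewrite /prop_for /continuous_at fg // => H.
  apply: cvg_trans H; apply: near_eq_cvg; exact: open_near_eq fg Ux.
move=> [df Hf]; split=> [x Ux|v].
  by apply: near_eq_differentiable (df x Ux); exact: open_near_eq fg Ux.
apply: IH (Hf v) => x Ux; apply: near_eq_derive; exact: open_near_eq fg Ux.
Qed.

Lemma CkS V W k (U : set V) (f : V -> W) : Ck k.+1 U f -> Ck k U f.
Proof.
elim: k f => [|k IH] f [df Hf].
  by move=> x Ux; exact: differentiable_continuous (df x Ux).
by split=> // v; exact: IH.
Qed.

Lemma CkD V W k (U : set V) (f g : V -> W) : open U ->
  Ck k U f -> Ck k U g -> Ck k U (f + g).
Proof.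
move=> oU; elim: k f g => [|k IH] f g /=.
  by move=> cf cg x Ux; apply: continuousD; [exact: cf|exact: cg].
move=> [df Hf] [dg Hg]; split=> [x Ux|v].
  by apply: differentiableD; [exact: df|exact: dg].
apply: Ck_eq (IH _ _ (Hf v) (Hg v)) => // x Ux.
by rewrite deriveD //; apply: diff_derivable; [exact: df|exact: dg].
Qed.

Lemma Ck_cst V W k (U : set V) (c : W) : Ck k U (cst c : V -> W).
Proof.
elim: k c => [|k IH] c /=; first by move=> x _; exact: cst_continuous.
split=> [x _|v]; first exact: differentiable_cst.
by rewrite (_ : 'D_v (cst c) = cst 0) //; apply/funext => x; rewrite derive_cst.
Qed.

Lemma Ck_id V k (U : set V) : Ck k U (id : V -> V).
Proof.
case: k => [|k] /=; first by move=> x _ ?.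
split=> [x _|v]; first exact: ex_diff.
rewrite (_ : 'D_v id = cst v); first exact: Ck_cst.
by apply/funext => x; rewrite derive_id.
Qed.

Lemma Ck_sum V W k (U : set V) n (f : 'I_n -> V -> W) : open U ->
  (forall i, Ck k U (f i)) -> Ck k U (\sum_i f i).
Proof.
move=> oU Hf; elim/big_ind: _ => //; first exact: Ck_cst.
by move=> ? ?; exact: CkD.
Qed.

Lemma Ck_lin_l V W (X : normedModType R) k (U : set V) (f : V -> W)
  (l : {linear W -> X}) : open U -> continuous l -> Ck k U f ->
  Ck k U (l \o f).
Proof.
move=> oU cl; elim: k f => [|k IH] f /=.
  by move=> cf x Ux; apply: continuous_comp; [exact: cf|exact: cl].
move=> [df Hf]; split=> [x Ux|v].
  apply: differentiable_comp; first exact: df.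
  exact: linear_differentiable.
apply: Ck_eq (IH _ (Hf v)) => // x Ux /=.
rewrite [RHS]deriveE; last first.
  by apply: differentiable_comp; [exact: df|exact: linear_differentiable].
rewrite diff_comp; [|exact: df|exact: linear_differentiable].
by rewrite /= diff_lin // deriveE //; exact: df.
Qed.

Lemma Ck_lin_r V W (X : normedModType R) k (U : set W) (f : W -> X)
  (l : {linear V -> W}) : open U -> continuous l -> Ck k U f ->
  Ck k (l @^-1` U) (f \o l).
Proof.
move=> oU cl; elim: k f => [|k IH] f /=.
  by move=> cf x Ux; apply: continuous_comp; [exact: cl|exact: cf].
move=> [df Hf].
have dl x : differentiable l x by exact: linear_differentiable.
split=> [x Ux|v]; first by apply: differentiable_comp => //; exact: df.
apply: Ck_eq (IH _ (Hf (l v))).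
  by apply: open_comp => // x _; exact: cl.
move=> x Ux /=; have dfl : differentiable f (l x) by exact: df.
rewrite [RHS]deriveE; last exact: differentiable_comp.
by rewrite diff_comp //= diff_lin // deriveE.
Qed.

Lemma CkM V k (U : set V) (f g : V -> R) : open U ->
  Ck k U f -> Ck k U g -> Ck k U (f * g).
Proof.
move=> oU; elim: k f g => [|k IH] f g.
  by move=> cf cg x Ux; apply: continuousM; [exact: cf|exact: cg].
move=> Hf Hg; have kf := CkS Hf; have kg := CkS Hg.
move: Hf Hg => [df Hf] [dg Hg]; split=> [x Ux|v].
  by apply: differentiableM; [exact: df|exact: dg].
apply: Ck_eq (CkD oU (IH _ _ kf (Hg v)) (IH _ _ (Hf v) kg)) => // x Ux.
rewrite deriveM /=; first by rewrite [X in _ + X = _]mulrC.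
- exact/diff_derivable/df.
- exact/diff_derivable/dg.
Qed.

Lemma rV_linear_continuous n W (l : {linear 'rV[R]_n -> W}) : continuous l.
Proof.
have -> : l = (\sum_i (fun v : 'rV[R]_n => v 0 i *: l (delta_mx 0 i)))
    :> ('rV[R]_n -> W).
  apply/funext => v; rewrite {1}(row_sum_delta v) linear_sum fct_sumE.
  by apply: eq_bigr => i _; rewrite linearZ.
elim/big_ind: _ => [|f g cf cg x|i _ x].
- by move=> x; exact: cst_continuous.
- by apply: continuousD; [exact: cf|exact: cg].
- by apply: continuousZr_tmp; exact: coord_continuous.
Qed.

Lemma Ck_scalel V W k (U : set V) (a : V -> R) (c : W) : open U ->
  Ck k U a -> Ck k U (fun x => a x *: c).
Proof.
move=> oU Ha.
have lc : linear (fun r : R => r *: c).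
  by move=> r x y; rewrite scalerDl scalerA.
pose L : {linear R -> W} :=
  HB.pack (fun r : R => r *: c) (GRing.isLinear.Build _ _ _ _ _ lc).
rewrite [X in Ck _ _ X](_ : _ = L \o a) //.
by apply: Ck_lin_l => // x; apply: continuousZr_tmp.
Qed.

Lemma Ck_coord V n k (U : set V) (f : V -> 'rV[R]_n) j : open U ->
  Ck k U f -> Ck k U (fun x => f x 0 j).
Proof.
move=> oU Hf.
have lc : linear (fun v : 'rV[R]_n => v 0 j : R).
  by move=> r x y; rewrite !mxE.
pose L : {linear 'rV[R]_n -> R} :=
  HB.pack (fun v : 'rV[R]_n => v 0 j : R) (GRing.isLinear.Build _ _ _ _ _ lc).
rewrite [X in Ck _ _ X](_ : _ = L \o f) //.
by apply: Ck_lin_l => //; exact: rV_linear_continuous.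
Qed.

Lemma CkZ V n k (U : set V) (a : V -> R) (f : V -> 'rV[R]_n) : open U ->
  Ck k U a -> Ck k U f -> Ck k U (fun x => a x *: f x).
Proof.
move=> oU Ha Hf.
rewrite [X in Ck _ _ X](_ : _ =
    \sum_j (fun x => (a * (fun x => f x 0 j)) x *: delta_mx 0 j)); last first.
  apply/funext => x; rewrite {1}(row_sum_delta (f x)) scaler_sumr fct_sumE.
  by apply: eq_bigr => j _; rewrite scalerA.
apply: Ck_sum => // j; apply: Ck_scalel => //; apply: CkM => //.
exact: Ck_coord.
Qed.

Lemma Ck_row_mx V m n k (U : set V) (f : V -> 'rV[R]_m) (g : V -> 'rV[R]_n) :
  open U -> Ck k U f -> Ck k U g -> Ck k U (fun x => row_mx (f x) (g x)).
Proof.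
move=> oU Hf Hg.
rewrite [X in Ck _ _ X](_ : _ = (mulmxr (row_mx 1%:M 0) \o f) +
                                (mulmxr (row_mx 0 1%:M) \o g)); last first.
  apply/funext => x; rewrite fctE /= !mul_mx_row !mulmx1 !mulmx0.
  by rewrite add_row_mx addr0 add0r.
by apply: CkD => //; apply: Ck_lin_l => //; exact: rV_linear_continuous.
Qed.

Lemma derive_sum_delta n W (f : 'rV[R]_n -> W) y v : differentiable f y ->
  'D_v f y = \sum_i v 0 i *: 'D_(delta_mx 0 i) f y.
Proof.
move=> df; rewrite deriveE // {1}(row_sum_delta v) linear_sum.
by apply: eq_bigr => i _; rewrite linearZ deriveE.
Qed.

End Smooth.


(* A smooth atlas on a bare set [M]: the charts [chart c : dom c -> 'rV_n] are
   injective, with open images of overlaps and smooth transition maps.  Each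
   point carries a preferred chart [chart_at p] around it.  [param c] inverts
   [chart c]; its values outside the image of [dom c] are irrelevant. *)
Record smoothAtlas (R : realType) (n : nat) (M : Type) := SmoothAtlas {
  chart_index : Type;
  dom : chart_index -> set M;
  chart : chart_index -> M -> 'rV[R]_n;
  param : chart_index -> 'rV[R]_n -> M;
  chart_at : M -> chart_index;
  chart_at_dom : forall p, dom (chart_at p) p;
  chartK : forall c p, dom c p -> param c (chart c p) = p;
  open_overlap : forall c d, open (chart c @` (dom c `&` dom d));
  smooth_transition : forall c d,
    smooth (chart c @` (dom c `&` dom d)) (chart d \o param c) }.

Arguments chart_index {R n M} s.
Arguments dom {R n M s} c.
Arguments chart {R n M s} c p.
Arguments param {R n M s} c y.
Arguments chart_at {R n M} s p.

(* T_p M, identified with 'rV_n by the differential at [p] of the preferred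
   chart at [p]. *)
Definition tangent (R : realType) (n : nat) (M : Type)
  (A : smoothAtlas R n M) (p : M) : Type := 'rV[R]_n.

Definition tbundle (R : realType) (n : nat) (M : Type)
  (A : smoothAtlas R n M) : Type := {p : M & tangent A p}.

Section TangentBundle.
Variables (R : realType) (n : nat) (M : Type) (A : smoothAtlas R n M).
Implicit Types (c d e : chart_index A) (p : M) (y v : 'rV[R]_n).

Definition coord_change c d y v : 'rV[R]_n := 'D_v (chart d \o param c) y.

Lemma transition_differentiable c d p : dom c p -> dom d p ->
  differentiable (chart d \o param c) (chart c p).
Proof.
move=> cp dp; have [df _] := @smooth_transition _ _ _ A c d 1%N.
by apply: df; exists p.
Qed.

Lemma coord_changeK c d e p v : dom c p -> dom d p -> dom e p ->
  coord_change d e (chart d p) (coord_change c d (chart c p) v) =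
  coord_change c e (chart c p) v.
Proof.
move=> cp dp ep; rewrite /coord_change.
have fd := transition_differentiable cp dp.
have gd := transition_differentiable dp ep.
have E : chart d p = (chart d \o param c) (chart c p) by rewrite /= chartK.
rewrite E in gd *.
rewrite (deriveE _ fd) (deriveE _ gd).
rewrite -[LHS]/(('d _ _ \o 'd _ _) v) -diff_comp // -deriveE; last first.
  exact: differentiable_comp.
apply: near_eq_derive.
apply: (open_near_eq (@open_overlap _ _ _ A c d)); last by exists p.
by move=> _ [q [cq dq] <-] /=; rewrite chartK // chartK.
Qed.

Lemma coord_change_id c p v : dom c p -> coord_change c c (chart c p) v = v.
Proof.
move=> cp; rewrite -[RHS](derive_id (chart c p)); apply: near_eq_derive.
apply: (open_near_eq (@open_overlap _ _ _ A c c)); last by exists p.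
by move=> _ [q [cq _] <-] /=; rewrite chartK.
Qed.

Definition tdom c : set (tbundle A) := [set z | dom c (tag z)].

Definition tchart c (z : tbundle A) : 'rV[R]_(n + n) :=
  let p := tag z in let k := chart_at A p in
  row_mx (chart c p) (coord_change k c (chart k p) (tagged z)).

Definition tparam c (w : 'rV[R]_(n + n)) : tbundle A :=
  let p := param c (lsubmx w) in
  existT (tangent A) p (coord_change c (chart_at A p) (lsubmx w) (rsubmx w)).

Lemma tchartK c z : tdom c z -> tparam c (tchart c z) = z.
Proof.
case: z => p u cp; rewrite /tparam /tchart /= row_mxKl row_mxKr.
rewrite chartK // coord_changeK //; try exact: chart_at_dom.
by rewrite coord_change_id //; exact: chart_at_dom.
Qed.

Lemma tchart_overlap c d :
  tchart c @` (tdom c `&` tdom d) =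
  lsubmx @^-1` (chart c @` (dom c `&` dom d)).
Proof.
apply/seteqP; split=> [_ [[p u] [/= cp dp] <-]|w [p [cp dp] E]].
  by exists p => //; rewrite row_mxKl.
exists (existT (tangent A) p
         (coord_change c (chart_at A p) (chart c p) (rsubmx w))) => //=.
rewrite /tchart /= coord_changeK ?coord_change_id //; try exact: chart_at_dom.
by rewrite E hsubmxK.
Qed.

Lemma topen_overlap c d : open (tchart c @` (tdom c `&` tdom d)).
Proof.
rewrite tchart_overlap; apply: open_comp; last exact: open_overlap.
by move=> w _; exact: continuous_lsubmx.
Qed.

Lemma tsmooth_transition c d :
  smooth (tchart c @` (tdom c `&` tdom d)) (tchart d \o tparam c).
Proof.
move=> k; have oU := @topen_overlap c d; rewrite tchart_overlap in oU *.
pose f := chart d \o param c : 'rV[R]_n -> 'rV[R]_n.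
have Hf : smooth (chart c @` (dom c `&` dom d)) f by exact: smooth_transition.
have oO := @open_overlap _ _ _ A c d.
pose pr : {linear 'rV[R]_(n + n) -> 'rV[R]_n} := mulmxr (col_mx 0 1%:M).
pose ls : {linear 'rV[R]_(n + n) -> 'rV[R]_n} := @lsubmx R 1 n n.
pose F := \sum_i (fun w => pr w 0 i *: ('D_(delta_mx 0 i) f \o ls) w).
have FE w : F w = \sum_i pr w 0 i *: 'D_(delta_mx 0 i) f (lsubmx w).
  by rewrite /F fct_sumE.
have eqF w : (ls @^-1` (chart c @` (dom c `&` dom d))) w ->
    row_mx ((f \o ls) w) (F w) = (tchart d \o tparam c) w.
  move=> [p [cp dp] E].
  rewrite /tchart /tparam /= -E chartK // coord_changeK //; last first.
    exact: chart_at_dom.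
  congr row_mx.
    by rewrite /f /= chartK.
  rewrite /coord_change -/f.
  rewrite derive_sum_delta; last exact: transition_differentiable.
  rewrite FE; apply: eq_bigr => i _; rewrite -[lsubmx w]/(ls w) -E.
  congr (_ 0 i *: _).
  by rewrite /pr /= -{1}(hsubmxK w) mul_row_col mulmx0 mulmx1 add0r.
apply: (Ck_eq oU eqF).
have cl : continuous ls by exact: rV_linear_continuous.
apply: Ck_row_mx => //; first exact: Ck_lin_r.
apply: Ck_sum => // i; apply: CkZ => //.
  apply: Ck_coord => //; apply: (@Ck_lin_l _ _ _ _ _ _ id pr) => //.
    exact: rV_linear_continuous.
  exact: Ck_id.
apply: Ck_lin_r => //.
have [_ Hk] := Hf k.+1; exact: Hk.
Qed.

Definition tangentAtlas : smoothAtlas R (n + n) (tbundle A) :=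
  @SmoothAtlas R (n + n) (tbundle A) (chart_index A) tdom tchart tparam
    (fun z => chart_at A (tag z)) (fun z => chart_at_dom A (tag z))
    tchartK topen_overlap tsmooth_transition.

End TangentBundle.

(* [atlas] is an atlas of homeomorphisms for the given topology. *)
Record smoothManifold (R : realType) (n : nat) := SmoothManifold {
  carrier :> topologicalType;
  atlas : smoothAtlas R n carrier;
  open_chartE : forall B : set carrier,
    open B <-> forall c, open (chart c @` (B `&` dom (s := atlas) c));
  manifold_hausdorff : hausdorff_space carrier;
  manifold_second_countable : @second_countable carrier }.

Section Tensors.
Variables (R : realType) (n : nat) (M : Type) (A : smoothAtlas R n M).

(* The coordinate vector field d/dy^i of the chart [c], at [param c y]. *)
Definition frame (c : chart_index A) (i : 'I_n) (y : 'rV[R]_n) :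
    tangent A (param c y) :=
  coord_change c (chart_at A (param c y)) y (delta_mx 0 i).

Definition gram (h : forall p, tangent A p -> tangent A p -> R)
    (c : chart_index A) (y : 'rV[R]_n) : 'M[R]_n :=
  \matrix_(i, j) h (param c y) (frame c i y) (frame c j y).

Record symTensor := SymTensor {
  form :> forall p, tangent A p -> tangent A p -> R;
  form_scalar : forall p (X : tangent A p), scalar (form X);
  form_sym : forall p (X Y : tangent A p), form X Y = form Y X;
  form_smooth : forall c i j,
    smooth (chart c @` dom c) (fun y => gram form c y i j) }.

Definition riemannian_metric (g : symTensor) : Prop :=
  forall p (X : tangent A p), X != 0 -> 0 < g p X X.

Definition nondegenerate_metric (h : symTensor) : Prop :=
  forall p (X : tangent A p), (forall Y, h p X Y = 0) -> X = 0.

Section LeviCivita.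
Variables (h : symTensor) (c : chart_index A).
Local Notation "'d_ i f" := ('D_(delta_mx 0 i) f)
  (at level 10, i at level 8, f at level 8).

(* Gamma^k_ij(y), the Christoffel symbols of the Levi-Civita connection of [h]
   (of any signature) in the chart [c]; [invmx (gram h c y) k l] is h^kl(y). *)
Definition christoffel (y : 'rV[R]_n) (i j k : 'I_n) : R :=
  2^-1 * \sum_l invmx (gram h c y) k l *
    ('d_ i (fun z => gram h c z j l) y + 'd_ j (fun z => gram h c z i l) y
     - 'd_ l (fun z => gram h c z i j) y).

Definition Gamma (y v w : 'rV[R]_n) : 'rV[R]_n :=
  \row_k \sum_i \sum_j v 0 i * w 0 j * christoffel y i j k.

(* nabla_X Y and [X, Y], for vector fields on the domain of [c] given by their
   components. *)
Definition nabla (X Y : 'rV[R]_n -> 'rV[R]_n) (y : 'rV[R]_n) : 'rV[R]_n :=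
  'D_(X y) Y y + Gamma y (X y) (Y y).

Definition lie_bracket (X Y : 'rV[R]_n -> 'rV[R]_n) (y : 'rV[R]_n) :
    'rV[R]_n :=
  'D_(X y) Y y - 'D_(Y y) X y.

(* Sign convention: R(X, Y) = [nabla_X, nabla_Y] - nabla_[X, Y]. *)
Definition curvature_field (X Y Z : 'rV[R]_n -> 'rV[R]_n) :
    'rV[R]_n -> 'rV[R]_n :=
  nabla X (nabla Y Z) - nabla Y (nabla X Z) - nabla (lie_bracket X Y) Z.

End LeviCivita.

(* R(X, Y)Z at [p] only depends on the values of the fields at [p]; it is
   computed on the extensions with constant components in the preferred chart,
   whose components at [p] are those of the tangent vectors. *)
Definition curvature (h : symTensor) (p : M) (X Y Z : tangent A p) :
    tangent A p :=
  curvature_field h (chart_at A p)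
    (cst (X : 'rV[R]_n)) (cst (Y : 'rV[R]_n)) (cst (Z : 'rV[R]_n))
    (chart (chart_at A p) p).

Definition jacobi (h : symTensor) (p : M) (X Y : tangent A p) : tangent A p :=
  curvature h X Y X.

End Tensors.

Definition is_eigenvalue (R : realType) (V : lmodType R) (f : V -> V)
    (a : R) : Prop :=
  exists2 v, f v = a *: v & v != 0.

Section Lifts.
Variables (R : realType) (n : nat) (M : Type) (A : smoothAtlas R n M).
Variable g : symTensor A.

(* In the chart (x, v) of TM induced by a chart x of M:
   X^h = X^i d/dx^i - Gamma^k_ij X^i u^j d/dv^k  and  X^v = X^k d/dv^k. *)
Definition hlift (p : M) (u X : tangent A p) :
    tangent (tangentAtlas A) (existT (tangent A) p u) :=
  row_mx (X : 'rV[R]_n)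
    (- Gamma g (chart_at A p) (chart (chart_at A p) p) X u).

Definition vlift (p : M) (u X : tangent A p) :
    tangent (tangentAtlas A) (existT (tangent A) p u) :=
  row_mx (0 : 'rV[R]_n) X.

Definition g_natural (G : symTensor (tangentAtlas A)) : Prop :=
  exists a1 a2 a3 b1 b2 b3 : R -> R,
    [/\ smooth_nonneg a1, smooth_nonneg a2 & smooth_nonneg a3] /\
    [/\ smooth_nonneg b1, smooth_nonneg b2 & smooth_nonneg b3] /\
    forall (p : M) (u X Y : tangent A p), let t := g p u u in
      let Gu := G (existT (tangent A) p u) in
      [/\ Gu (hlift u X) (hlift u Y) =
            (a1 t + a3 t) * g p X Y + (b1 t + b3 t) * g p X u * g p Y u,
          Gu (hlift u X) (vlift u Y) =
            a2 t * g p X Y + b2 t * g p X u * g p Y u,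
          Gu (vlift u X) (hlift u Y) =
            a2 t * g p X Y + b2 t * g p X u * g p Y u &
          Gu (vlift u X) (vlift u Y) =
            a1 t * g p X Y + b1 t * g p X u * g p Y u].

End Lifts.

(* Main.v *)
Require Import Defs.
From HB Require Import structures.
From mathcomp Require Import all_boot all_order all_algebra.
From mathcomp Require Import all_classical all_reals all_analysis.
From mathcomp Require Import ring lra.

Set Implicit Arguments.
Unset Strict Implicit.
Unset Printing Implicit Defensive.

Import Order.TTheory GRing.Theory Num.Theory.
Import numFieldNormedType.Exports.
Local Open Scope classical_set_scope.
Local Open Scope ring_scope.

(** The zero section of TM is totally geodesic for every nondegenerate
g-natural metric G, and G restricts to it as the constant multiple
(alpha1 + alpha3)(0) of g.  Hence the curvature of G at a point (x, 0),
evaluated on horizontal vectors, is the horizontal lift of the curvature of g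
([curvature_zero_section]), and the horizontal lift of an eigenvector of J_X is
an eigenvector of the Jacobi operator of X^h for the same eigenvalue.

Everything is computed in a chart c of M and the induced chart (y, v) of TM.
Both curvatures are taken on fields with constant components, so that only the
Christoffel forms and their first derivatives occur.  For horizontal arguments
these derivatives are taken in directions (X, 0), that is, along the zero
section, and it is enough to know there that
  Gamma_G (y, 0) ((X, 0), (Y, 0)) = (Gamma_g y (X, Y), 0),
which is [Gamma_zero_section].  Second derivatives of G transverse to the zero
section never enter.

By nondegeneracy this identity can be tested against a vector b of TM through
the Koszul formula ([koszul]).
- For b = (Z, 0), only the values of G on horizontal vectors along the zero
  section matter, and these are (alpha1 + alpha3)(0) g.
- For b = (0, Z), two of the three Koszul terms are derivatives of
  alpha2(0) g along the zero section.  The third is the derivative of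
  G((X, 0), (Y, 0)) along the fibre, in the direction Z.  It must equal
  alpha2(0) times the derivative of g(X, Y) along Z on M, and this is where
  the shape of a g-natural metric is used.

For this last term, G is known in terms of lifts, which are described in the
preferred chart k of the point p under consideration, whereas the derivative is
taken in the fixed chart c.  Write X', Y', Z' for the components of X, Y, Z
in k, phi for the transition from c to k, and
  F X = D_X (D_Z phi) + Gamma_k (X', Z').
At (y, s Z), the coordinate vector (X, 0) of c is the horizontal lift of X'
plus the vertical lift of s (F X).  So G((X, 0), (Y, 0)) is
(alpha1 + alpha3)(t) g(X', Y') + s alpha2(t) (g(X', F Y) + g(F X, Y'))
+ O(s ^ 2), where t = s ^ 2 g(Z', Z') has no first-order part, and its
derivative at s = 0 is alpha2(0) (g(X', F Y) + g(F X, Y'))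
([is_derive_along_fibre]).  On the other hand, differentiating
g(X, Y) = g_k(phi)(D_X phi, D_Y phi) along Z, and using that the Levi-Civita
connection of g is metric ([chart_form_parallel]), gives
g(X', F Y) + g(F X, Y') too ([derive_chart_form_transport]), because the
second derivative of phi is symmetric ([derive_comm_rV]). *)

(** * Directional derivatives and the symmetry of second derivatives *)

Section Calculus.
Variable R : realType.
Implicit Types V W : normedModType R.

(** A directional derivative only sees the function on a line, so it can be
    transferred between functions on different spaces. *)
Lemma is_derive_along V V' W (f : V -> W) (g : V' -> W) x v y w l :
    (\forall h \near (0 : R), f (h *: v + x) = g (h *: w + y)) ->
  is_derive x v f l -> is_derive y w g l.
Proof.
move=> fg [df dl].
have fg0 : f x = g y by have := nbhs_singleton fg; rewrite !scale0r !add0r.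
have cf : (fun h => h^-1 *: (f (h *: v + x) - f x)) @ 0^' --> l.
  by rewrite -dl; exact: df.
have cg : (fun h => h^-1 *: (g (h *: w + y) - g y)) @ 0^' --> l.
  apply: cvg_trans cf; apply: near_eq_cvg; apply: cvg_within.
  by near=> h; rewrite -fg0; congr (_ *: (_ - _)); near: h.
by split; [apply/cvg_ex; exists l|exact: cvg_lim cg].
Unshelve. all: by end_near. Qed.

Lemma is_derive_line V W (f : V -> W) x u s l :
  is_derive (s *: u + x) u f l ->
  is_derive s (1 : R) (fun r : R => f (r *: u + x)) l.
Proof.
apply: is_derive_along; near=> h.
by rewrite scalerDl addrA -scalerA scale1r.
Unshelve. all: by end_near. Qed.

Lemma near0_line V (P : set V) (x v : V) : (\forall y \near x, P y) ->
  \forall h \near (0 : R), P (h *: v + x).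
Proof.
move=> Px; have : {for (0:R), continuous (fun h : R => h *: v + x)}.
  by apply: continuousD; [exact: continuousZr_tmp|exact: cst_continuous].
by apply; rewrite scale0r add0r.
Qed.

Lemma differentiable_expansion V (f : V -> R) x : differentiable f x ->
  forall e, 0 < e ->
  \forall k \near (0 : V), `|f (k + x) - f x - 'D_k f x| <= e * `|k|.
Proof.
move=> df e e0; have [_ /eqaddoP /(_ e e0)] := (diff_locallyP _ _).1 df.
move=> H; near=> k; rewrite deriveE // -addrA -opprD.
by near: k.
Unshelve. all: by end_near. Qed.

(** The second difference of f over the parallelogram h u, h v is
    h ^ 2 D_v (D_u f) up to o(h ^ 2): by the mean value theorem along u, it is
    h times the increment of D_u f over h v.  The expression being symmetric in
    u and v, this yields the symmetry of second derivatives. *)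
Lemma second_difference V (f : V -> R) x u v :
    (\forall y \near x, differentiable f y) ->
    differentiable ('D_u f) x -> forall e, 0 < e ->
  \forall h \near 0^'+,
    `|f (h *: u + h *: v + x) - f (h *: u + x) - f (h *: v + x) + f x
      - h ^+ 2 * 'D_v ('D_u f) x| <= e * h ^+ 2.
Proof.
move=> df dDf e e0.
(* The two expansions of D_u f are used at vectors of norm at most
   h (|u| + |v|) and h |u|; adding 1 makes C positive. *)
pose C := 2 * `|u| + `|v| + 1.
have C0 : 0 < C by rewrite ltr_wpDl // addr_ge0 // mulr_ge0.
have [Cu Cuv Cuvu] : [/\ `|u| <= C, `|u| + `|v| <= C & `|u| + `|v| + `|u| <= C].
  by rewrite /C; have := normr_ge0 u; have := normr_ge0 v; split; lra.
have [d /= d0 Hd] : exists2 d, 0 < d & forall k : V, `|k| < d ->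
    differentiable f (k + x) /\
    `|'D_u f (k + x) - 'D_u f x - 'D_k ('D_u f) x| <= e / C * `|k|.
  have H1 : \forall k \near (0 : V), differentiable f (k + x).
    by move: df; rewrite (near_shift 0) subr0.
  have H2 := differentiable_expansion dDf (divr_gt0 e0 C0).
  have /nbhs_normP[d /= d0 Hd] : \forall k \near (0 : V),
      differentiable f (k + x) /\
      `|'D_u f (k + x) - 'D_u f x - 'D_k ('D_u f) x| <= e / C * `|k|.
    by near=> k; split; near: k.
  exists d => // k kd; apply: Hd => /=.
  by rewrite sub0r normrN.
near=> h.
have h0 : 0 < h by near: h; exact: nbhs_right_gt.
have hC : h * C < d.
  by rewrite -ltr_pdivlMr //; near: h; apply: nbhs_right_lt; exact: divr_gt0.
pose phi s := f (s *: u + (h *: v + x)) - f (s *: u + x).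
have nu s : 0 <= s <= h -> `|s *: u| <= h * `|u|.
  by move=> /andP[s0 sh]; rewrite normrZ ger0_norm // ler_wpM2r.
have nuv s : 0 <= s <= h -> `|s *: u + h *: v| <= h * (`|u| + `|v|).
  move=> sh; rewrite mulrDr (le_trans (ler_normD _ _)) // lerD ?nu //.
  by rewrite normrZ gtr0_norm.
have lu s : 0 <= s <= h -> `|s *: u| < d.
  move=> sh; apply: le_lt_trans (nu _ sh) (le_lt_trans _ hC).
  by rewrite ler_pM2l.
have luv s : 0 <= s <= h -> `|s *: u + h *: v| < d.
  move=> sh; apply: le_lt_trans (nuv _ sh) (le_lt_trans _ hC).
  by rewrite ler_pM2l.
have dphi s : 0 <= s <= h -> is_derive s (1 : R) phi
    ('D_u f (s *: u + h *: v + x) - 'D_u f (s *: u + x)).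
  move=> sh; apply: is_deriveB; apply: is_derive_line.
    rewrite addrA; apply/derivableP/diff_derivable.
    by have [] := Hd _ (luv _ sh).
  by apply/derivableP/diff_derivable; have [] := Hd _ (lu _ sh).
have sub s : s \in `]0, h[ -> 0 <= s <= h.
  by rewrite in_itv /= => /andP[/ltW-> /ltW->].
have cphi : {within `[0, h], continuous phi}.
  apply: derivable_within_continuous => s; rewrite in_itv /= => sh.
  by have [] := dphi s sh.
have [s /sub sh] := MVT h0 (fun s ss => dphi s (sub s ss)) cphi.
rewrite /phi subr0 !scale0r !add0r addrA.
have [_ r1] := Hd _ (luv _ sh).
have [_ r2] := Hd _ (lu _ sh).
have lin : 'D_(s *: u + h *: v) ('D_u f) x =
    'D_(s *: u) ('D_u f) x + h * 'D_v ('D_u f) x.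
  by rewrite !deriveE // linearD [X in _ + X]linearZ.
rewrite lin in r1 => E.
move: r1 r2 E.
set A := 'D_u f _; set B := 'D_u f _; set B' := 'D_u f _.
set L := 'D_v _ _; set Ls := 'D_(s *: u) _ _ => r1 r2 E.
have -> : f (h *: u + h *: v + x) - f (h *: u + x) - f (h *: v + x) + f x
    - h ^+ 2 * L = h * ((A - B - (Ls + h * L)) - (B' - B - Ls)).
  have -> : f (h *: u + h *: v + x) - f (h *: u + x) - f (h *: v + x) + f x =
    (A - B') * h by rewrite -E; ring.
  ring.
rewrite normrM gtr0_norm // expr2 mulrCA ler_pM2l //.
apply: le_trans (ler_normB _ _) _.
apply: le_trans (lerD r1 r2) _.
rewrite -mulrDr mulrAC ler_pdivrMr // -mulrA ler_pM2l //.
apply: le_trans (lerD (nuv _ sh) (nu _ sh)) _.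
by rewrite -mulrDr ler_pM2l.
Unshelve. all: by end_near. Qed.

Lemma derive_comm V (f : V -> R) x u v :
    (\forall y \near x, differentiable f y) ->
    differentiable ('D_u f) x -> differentiable ('D_v f) x ->
  'D_v ('D_u f) x = 'D_u ('D_v f) x.
Proof.
move=> df du dv; apply/eqP; rewrite -subr_eq0 -normr_le0; apply/ler_addgt0Pr.
move=> e e0; rewrite add0r.
have e2 : 0 < e / 2 by rewrite divr_gt0.
have H1 := second_difference v df du e2.
have H2 := second_difference u df dv e2.
have [h [h0 [{}H1 {}H2]]] := filter_ex (filterI (nbhs_right_gt 0) (filterI H1 H2)).
have hh : 0 < h ^+ 2 by rewrite exprn_gt0.
move: H1 H2; rewrite [h *: v + h *: u]addrC.
set D := 'D_v _ _; set D' := 'D_u _ _.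
set a := f (_ + _ + _); set b := f (_ + _); set c := f (_ + _) => H1 H2.
rewrite -(ler_pM2l hh) -{1}(gtr0_norm hh) -normrM.
have -> : h ^+ 2 * (D - D') = (a - c - b + f x - h ^+ 2 * D') -
   (a - b - c + f x - h ^+ 2 * D) by ring.
apply: le_trans (ler_normB _ _) (le_trans (lerD H2 H1) _).
by rewrite -mulrDl -splitr mulrC.
Unshelve. all: by end_near. Qed.

End Calculus.

Section DirectionalDerivatives.
Variable R : realType.
Implicit Types V W : normedModType R.

Lemma is_derive_comp V V' W (f : V -> V') (g : V' -> W) x v :
  differentiable f x -> differentiable g (f x) ->
  is_derive x v (g \o f) ('D_('D_v f x) g (f x)).
Proof.
move=> df dg; have dgf := differentiable_comp df dg.
by split; [exact: diff_derivable|rewrite !deriveE // diff_comp].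
Qed.

Lemma is_derive_row_mx V m1 m2 (f : V -> 'rV[R]_m1) (g : V -> 'rV[R]_m2)
    x v l1 l2 :
  is_derive x v f l1 -> is_derive x v g l2 ->
  is_derive x v (fun y => row_mx (f y) (g y)) (row_mx l1 l2).
Proof.
move=> [df <-] [dg <-].
have El (j : 'I_m1) i : (fun y => row_mx (f y) (g y) i (lshift m2 j)) =
    fun y => f y i j.
  by apply/funext => y; rewrite row_mxEl.
have Er (j : 'I_m2) i : (fun y => row_mx (f y) (g y) i (rshift m1 j)) =
    fun y => g y i j.
  by apply/funext => y; rewrite row_mxEr.
have dfg : derivable (fun y => row_mx (f y) (g y)) x v.
  apply/derivable_mxP => i j; case: (split_ordP j) => k ->.
    by rewrite El; exact: (derivable_mxP _ _ _).1.
  by rewrite Er; exact: (derivable_mxP _ _ _).1.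
split=> //; rewrite derive_mx // (derive_mx df) (derive_mx dg).
apply/matrixP => i j; rewrite mxE; case: (split_ordP j) => k ->.
  by rewrite row_mxEl mxE El.
by rewrite row_mxEr mxE Er.
Qed.

Lemma is_derive_entry V m1 m2 (f : V -> 'M[R]_(m1, m2)) x v i j :
  derivable f x v -> is_derive x v (fun y => f y i j) ('D_v f x i j).
Proof.
move=> df; rewrite (derive_mx df) mxE; apply: derivableP.
exact: ((derivable_mxP f x v).1 df i j).
Qed.

Lemma derive_comm_rV V m (f : V -> 'rV[R]_m) x u v :
    (\forall y \near x, differentiable f y) ->
    differentiable ('D_u f) x -> differentiable ('D_v f) x ->
  'D_v ('D_u f) x = 'D_u ('D_v f) x.
Proof.
move=> df du dv; apply/rowP => j.
pose fj y : R := f y 0 j.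
have dfj y : differentiable f y -> differentiable fj y.
  by move=> dfy; exact: (differentiable_comp dfy (differentiable_coord _ 0 j)).
have E w y : differentiable f y -> 'D_w fj y = 'D_w f y 0 j.
  move=> dfy; apply: derive_val; apply: is_derive_entry.
  exact: diff_derivable.
have nE w : \near x, 'D_w f x 0 j = 'D_w fj x.
  by apply: filterS df => y dfy; rewrite E.
have dE w : differentiable ('D_w f) x -> differentiable ('D_w fj) x.
  move=> dw; apply: near_eq_differentiable (nE w) _.
  exact: (differentiable_comp dw (differentiable_coord _ 0 j)).
have [_ E1] := is_derive_entry 0 j (@diff_derivable _ _ _ _ x v du).
have [_ E2] := is_derive_entry 0 j (@diff_derivable _ _ _ _ x u dv).
apply: etrans (esym E1) (etrans _ E2).
rewrite (near_eq_derive v (nE u)) (near_eq_derive u (nE v)).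
apply: derive_comm; [|exact: dE|exact: dE].
by apply: filterS df => y; exact: dfj.
Qed.

End DirectionalDerivatives.

(** * Derivability of the inverse of a matrix *)

Section MatrixInverse.
Variable R : realType.
Implicit Types V W : normedModType R.

Lemma derivable_prod V (I : Type) (r : seq I) (f : I -> V -> R) x v :
  (forall i, derivable (f i) x v) ->
  derivable (fun y => \prod_(i <- r) f i y) x v.
Proof.
move=> df; rewrite (_ : (fun y => _) = \prod_(i <- r) f i); last first.
  by apply/funext => y; rewrite fct_prodE.
elim/big_ind: _ => [|f1 f2 d1 d2|//]; first exact: (@derivable_cst R V R 1 x v).
exact: derivableM.
Qed.

Lemma derivable_sumf V W (I : Type) (r : seq I) (P : pred I) (f : I -> V -> W)
    x v : (forall i, derivable (f i) x v) ->
  derivable (fun y => \sum_(i <- r | P i) f i y) x v.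
Proof.
move=> df; rewrite (_ : (fun y => _) = \sum_(i <- r | P i) f i); last first.
  by apply/funext => y; rewrite fct_sumE.
elim/big_ind: _ => [|f1 f2 d1 d2|//]; first exact: (derivable_cst 0).
exact: derivableD.
Qed.

Lemma derivable_det V n (A : V -> 'M[R]_n) x v :
  (forall i j, derivable (fun y => A y i j) x v) ->
  derivable (fun y => \det (A y)) x v.
Proof.
move=> dA; apply: derivable_sumf => s; apply: derivableM.
  exact: derivable_cst.
exact: derivable_prod.
Qed.

(** The entries of the inverse are cofactors divided by the determinant. *)
Lemma derivable_invmx V n (A : V -> 'M[R]_n) x v i j :
  (forall i j, derivable (fun y => A y i j) x v) ->
  (\forall y \near x, A y \in unitmx) ->
  derivable (fun y => invmx (A y) i j) x v.
Proof.
move=> dA uA.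
have : derivable (fun y => (\det (A y))^-1 * (\adj (A y)) i j) x v.
  apply: derivableM.
    apply: derivableV; last exact: derivable_det.
    by have := nbhs_singleton uA; rewrite unitmxE unitfE.
  rewrite (_ : (fun y => _) = fun y =>
    (-1) ^+ (j + i) * \det (row' j (col' i (A y)))); last first.
    by apply/funext => y; rewrite mxE.
  apply: derivableM; first exact: derivable_cst.
  apply: derivable_det => k l.
  by rewrite (_ : (fun y => _) = fun y => A y (lift j k) (lift i l)) //;
    apply/funext => y; rewrite !mxE.
apply: near_eq_derivable; near=> y.
have uy : A y \in unitmx by near: y.
by rewrite /invmx uy [RHS]mxE.
Unshelve. all: by end_near. Qed.

End MatrixInverse.

(** * First-order expansions at 0 *)

(** A coefficient of a g-natural metric is evaluated at t = g(u, u), which is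
    s ^ 2 * q along the ray u = s Z: no first-order term arises from it. *)
Lemma smooth_nonneg_square (R : realType) (a : R -> R) (q : R) :
  smooth_nonneg a -> 0 <= q ->
  is_derive (0 : R) (1 : R) (fun s => a (s ^+ 2 * q)) 0.
Proof.
move=> [b sb ab] q0.
have -> : (fun s => a (s ^+ 2 * q)) = b \o ((fun s : R => s ^+ 2) * cst q).
  by apply/funext => s; rewrite ab // mulr_ge0 // sqr_ge0.
have dq : is_derive (0 : R) (1 : R) ((fun s : R => s ^+ 2) * cst q) 0.
  apply: is_derive_eq.
  by rewrite /GRing.scale /=; ring.
have [db _] := sb 1%N.
have := @is_derive_comp _ _ _ _ _ _ _ (1 : R) 
  ((derivable1_diffP _ _).1 dq.(ex_derive)) (db _ I).
by rewrite derive_val derive0.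
Qed.

(** For the metric along a ray, f * cst r is the part that depends on s ^ 2 only,
    and Q 0 is the first-order coefficient. *)
Lemma is_derive_first_order (R : realType) (f Q : R -> R) (r l : R) :
  is_derive (0 : R) (1 : R) f 0 -> derivable Q 0 1 -> Q 0 = l ->
  is_derive (0 : R) (1 : R) (f * cst r + id * Q) l.
Proof.
move=> df dQ <-; have dQ' := derivableP dQ.
have H := is_deriveD (is_deriveM df (@is_derive_cst R R R r 0 1))
  (is_deriveM (@is_derive_id R R 0 1) dQ').
by apply: (is_derive_eq H); rewrite /GRing.scale /=; ring.
Qed.

(* From here on directional derivatives are only handled through their rules;
   hiding the underlying limit keeps unification from exploring it. *)
Local Opaque derive.

(** * The Levi-Civita connection in a chart *)

Section ChartForm.
Variables (R : realType) (n : nat) (M : Type) (A : smoothAtlas R n M).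
Implicit Types (c d : chart_index A) (p : M) (y v w z a b u : 'rV[R]_n).

Lemma open_chart c : open (chart c @` dom c).
Proof. by rewrite -[X in _ @` X]setIid; exact: open_overlap. Qed.

Lemma coord_change_linear c d p : dom c p -> dom d p ->
  linear (coord_change c d (chart c p)).
Proof.
move=> cp dp k a b; rewrite /coord_change.
by rewrite !deriveE ?linearP //; exact: transition_differentiable.
Qed.

Lemma coord_change0 c d y : coord_change c d y 0 = 0.
Proof. exact: derive0. Qed.

Lemma coord_changeVK c d p v : dom c p -> dom d p ->
  coord_change d c (chart d p) (coord_change c d (chart c p) v) = v.
Proof. by move=> cp dp; rewrite coord_changeK // coord_change_id. Qed.

Variable h : symTensor A.

Lemma tensorDr p (X Y Z : tangent A p) : h p X (Y + Z) = h p X Y + h p X Z.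
Proof. by have := form_scalar h X 1 Y Z; rewrite scale1r mul1r. Qed.

Lemma tensorDl p (X Y Z : tangent A p) : h p (X + Y) Z = h p X Z + h p Y Z.
Proof. by rewrite ![h p _ Z]form_sym tensorDr. Qed.

Lemma tensor0r p (X : tangent A p) : h p X 0 = 0.
Proof. by apply: (addrI (h p X 0)); rewrite -tensorDr !addr0. Qed.

Lemma tensor0l p (X : tangent A p) : h p 0 X = 0.
Proof. by rewrite form_sym tensor0r. Qed.

Lemma tensorZr p (X Y : tangent A p) (s : R) : h p X (s *: Y) = s * h p X Y.
Proof. by have := form_scalar h X s Y 0; rewrite tensor0r !addr0. Qed.

Lemma tensorZl p (X Y : tangent A p) (s : R) : h p (s *: X) Y = s * h p X Y.
Proof. by rewrite form_sym tensorZr form_sym. Qed.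

(** The pull-back of h by the parametrisation of the chart c: for y in the image
    of c, the bilinear form with Gram matrix [gram h c y]. *)
Definition chart_form c y a b : R :=
  h (param c y) (coord_change c (chart_at A (param c y)) y a)
    (coord_change c (chart_at A (param c y)) y b).

Lemma chart_formE c p a b : dom c p ->
  chart_form c (chart c p) a b =
  h p (coord_change c (chart_at A p) (chart c p) a)
    (coord_change c (chart_at A p) (chart c p) b).
Proof. by move=> cp; rewrite /chart_form chartK. Qed.

Lemma chart_form_at p (X Y : tangent A p) :
  chart_form (chart_at A p) (chart (chart_at A p) p) X Y = h p X Y.
Proof.
rewrite chart_formE; last exact: chart_at_dom.
by rewrite !coord_change_id //; exact: chart_at_dom.
Qed.

(** Independence of h from the chart: a change of chart is an isometry between
    its expressions. *)
Lemma chart_form_change c d p a b : dom c p -> dom d p ->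
  chart_form c (chart c p) a b =
  chart_form d (chart d p) (coord_change c d (chart c p) a)
                           (coord_change c d (chart c p) b).
Proof.
move=> cp dp; have kp := chart_at_dom A p.
rewrite (chart_formE _ _ cp) (chart_formE _ _ dp).
by rewrite (coord_changeK a cp dp kp) (coord_changeK b cp dp kp).
Qed.

Lemma chart_form_sym c y a b : chart_form c y a b = chart_form c y b a.
Proof. exact: form_sym. Qed.

Lemma chart_form_linear c y a : (chart c @` dom c) y ->
  scalar (chart_form c y a).
Proof.
move=> [p cp <-] k b b'; rewrite !chart_formE //.
rewrite coord_change_linear //; last exact: chart_at_dom.
exact: form_scalar.
Qed.

Lemma chart_formDr c y a b b' : (chart c @` dom c) y ->
  chart_form c y a (b + b') = chart_form c y a b + chart_form c y a b'.
Proof.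
by move=> Uy; have := chart_form_linear a Uy 1 b b'; rewrite scale1r mul1r.
Qed.

Lemma chart_form_mx c y a b : (chart c @` dom c) y ->
  chart_form c y a b = (a *m gram h c y *m b^T) 0 0.
Proof.
move=> Uy.
have L a' := chart_form_linear a' Uy.
pose F a' : {scalar 'rV[R]_n} :=
  HB.pack (chart_form c y a') (GRing.isLinear.Build _ _ _ _ _ (L a')).
have FE a' b' : chart_form c y a' b' = \sum_j b' 0 j * chart_form c y a' (delta_mx 0 j).
  rewrite -[LHS]/(F a' b') {1}(row_sum_delta b') linear_sum.
  by apply: eq_bigr => j _; rewrite linearZ.
rewrite FE mxE; apply: eq_bigr => j _; rewrite chart_form_sym FE.
rewrite !mxE mulrC; congr (_ * _); apply: eq_bigr => i _.
by rewrite mxE chart_form_sym.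
Qed.

Lemma chart_form_sum c y a b : (chart c @` dom c) y ->
  chart_form c y a b = \sum_i \sum_j a 0 i * b 0 j * gram h c y i j.
Proof.
move=> Uy; rewrite chart_form_mx // mxE.
under eq_bigr do rewrite mxE mulr_suml.
rewrite exchange_big; apply: eq_bigr => i _; apply: eq_bigr => j _.
by rewrite [b^T _ _]mxE mulrAC.
Qed.

Lemma gram_sym c y : (gram h c y)^T = gram h c y.
Proof. by apply/matrixP => i j; rewrite !mxE; exact: form_sym. Qed.

Lemma gram_Ck c i j k : Ck k (chart c @` dom c) (fun y => gram h c y i j).
Proof. exact: form_smooth. Qed.

Lemma gram_differentiable c y i j : (chart c @` dom c) y ->
  differentiable (fun y => gram h c y i j) y.
Proof. by have [H _] := @gram_Ck c i j 1; exact: H. Qed.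

Lemma derive_gram_differentiable c y i j v : (chart c @` dom c) y ->
  differentiable ('D_v (fun y => gram h c y i j)) y.
Proof. by have [_ /(_ v)[H _]] := @gram_Ck c i j 2; exact: H. Qed.

Lemma is_derive_chart_form c y a b u : (chart c @` dom c) y ->
  is_derive y u (fun z => chart_form c z a b)
   (\sum_i \sum_j a 0 i * b 0 j * 'D_u (fun z => gram h c z i j) y).
Proof.
move=> Uy; apply: (@near_eq_is_derive _ _ _
  (\sum_i \sum_j (fun z => a 0 i * b 0 j *: gram h c z i j))).
  near=> z; have Uz : (chart c @` dom c) z.
    by near: z; apply: open_nbhs_nbhs; split => //; exact: open_chart.
  rewrite chart_form_sum // fct_sumE; apply: eq_bigr => i _.
  by rewrite fct_sumE.
apply: is_derive_sum => i; apply: is_derive_sum => j; apply: is_deriveZ.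
exact/derivableP/diff_derivable/gram_differentiable.
Unshelve. all: by end_near. Qed.

Lemma is_derive_chart_form_along (V : normedModType R) c (x u : V)
    (f a b : V -> 'rV[R]_n) :
    (chart c @` dom c) (f x) -> differentiable f x ->
    derivable a x u -> derivable b x u ->
  is_derive x u (fun t => chart_form c (f t) (a t) (b t))
    ('D_('D_u f x) (fun z => chart_form c z (a x) (b x)) (f x) +
     chart_form c (f x) ('D_u a x) (b x) + chart_form c (f x) (a x) ('D_u b x)).
Proof.
move=> Uf df da db.
have da' i : is_derive x u (fun t => a t 0 i) ('D_u a x 0 i).
  exact: is_derive_entry.
have db' i : is_derive x u (fun t => b t 0 i) ('D_u b x 0 i).
  exact: is_derive_entry.
have dg i j : is_derive x u (fun t => gram h c (f t) i j)
    ('D_('D_u f x) (fun z => gram h c z i j) (f x)).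
  exact: (is_derive_comp u df (gram_differentiable _ _ Uf)).
apply: (@near_eq_is_derive _ _ _ (\sum_i \sum_j
    ((fun t => a t 0 i) * (fun t => b t 0 j) * (fun t => gram h c (f t) i j)))).
  have cf : {for x, continuous f} by exact: differentiable_continuous.
  near=> t; have Ut : (chart c @` dom c) (f t).
    near: t; apply: cf; apply: open_nbhs_nbhs; split => //; exact: open_chart.
  rewrite chart_form_sum // fct_sumE; apply: eq_bigr => i _.
  by rewrite fct_sumE.
apply: is_derive_eq.
rewrite (@derive_val _ _ _ _ _ _ _ (is_derive_chart_form _ _ _ Uf)).
rewrite !chart_form_sum // -!big_split; apply: eq_bigr => i _ /=.
rewrite -!big_split; apply: eq_bigr => j _ /=.
rewrite /GRing.scale /= !fctE; ring.
Unshelve. all: by end_near. Qed.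

Section Nondegenerate.
Hypothesis h_nondeg : nondegenerate_metric h.

Lemma chart_form_nondeg c y a : (chart c @` dom c) y ->
  (forall b, chart_form c y a b = 0) -> a = 0.
Proof.
move=> [p cp <-] a0; have kp := chart_at_dom A p.
rewrite -(coord_changeVK a cp kp) [coord_change c _ _ _](_ : _ = 0) ?coord_change0 //.
apply: (h_nondeg (p := p)) => Y.
by rewrite -(coord_changeVK Y kp cp) -chart_formE.
Qed.

Lemma chart_form_inj c y a a' : (chart c @` dom c) y ->
  (forall b, chart_form c y a b = chart_form c y a' b) -> a = a'.
Proof.
move=> Uy aa'; apply/eqP; rewrite -subr_eq0; apply/eqP.
apply: (chart_form_nondeg Uy) => b; move: (aa' b).
by rewrite !chart_form_mx // !mulmxBl !mxE => ->; rewrite subrr.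
Qed.

Lemma gram_unit c y : (chart c @` dom c) y -> gram h c y \in unitmx.
Proof.
move=> Uy; rewrite -row_free_unit; apply: inj_row_free => a a0.
apply: (chart_form_nondeg Uy) => b.
by rewrite chart_form_mx // a0 mul0mx mxE.
Qed.

(** The Christoffel symbols are the solution of the linear system that the
    Koszul formula gives on the coordinate fields; it is solvable for any
    signature, the Gram matrix being invertible. *)
Lemma koszul c y v w z : (chart c @` dom c) y ->
  2 * chart_form c y (Gamma h c y v w) z =
  'D_v (fun x => chart_form c x w z) y + 'D_w (fun x => chart_form c x v z) y
  - 'D_z (fun x => chart_form c x v w) y.
Proof.
move=> Uy.
pose D i j l := 'D_(delta_mx 0 i) (fun x => gram h c x j l) y.
pose K i j l := D i j l + D j i l - D l i j.
have DE u a b : 'D_u (fun x => chart_form c x a b) y =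
    \sum_i \sum_j \sum_l u 0 i * a 0 j * b 0 l * D i j l.
  rewrite (@derive_val _ _ _ _ _ _ _ (is_derive_chart_form a b u Uy)).
  rewrite [RHS]exchange_big; apply: eq_bigr => i _.
  rewrite [RHS]exchange_big; apply: eq_bigr => j _.
  rewrite derive_sum_delta; last exact: gram_differentiable.
  rewrite mulr_sumr; apply: eq_bigr => l _.
  by rewrite -/(D l i j) [_ *: _]/(u 0 l * D l i j) mulrCA -!mulrA.
(* Twice the Christoffel form, with its index lowered. *)
pose kv : 'rV[R]_n := \row_l \sum_i \sum_j v 0 i * w 0 j * K i j l.
have -> : Gamma h c y v w = 2^-1 *: (kv *m invmx (gram h c y)).
  apply/rowP => k; rewrite !mxE mulr_sumr.
  under [RHS]eq_bigr do rewrite mxE mulr_suml mulr_sumr.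
  rewrite [RHS]exchange_big; apply: eq_bigr => i _.
  under [RHS]eq_bigr do rewrite mulr_suml mulr_sumr.
  rewrite [RHS]exchange_big; apply: eq_bigr => j _.
  rewrite /christoffel mulrA mulr_sumr; apply: eq_bigr => l _.
  rewrite -[in RHS]gram_sym -trmx_inv [_^T l k]mxE /K /D; ring.
rewrite chart_form_mx // -2!scalemxAl mulmxKV ?gram_unit // [X in 2 * X]mxE.
rewrite mulrA divff ?mul1r //.
rewrite !DE mxE.
under eq_bigr do rewrite !mxE mulr_suml.
rewrite exchange_big [X in _ + X - _]exchange_big.
rewrite [X in _ - X](_ : _ = \sum_i \sum_j \sum_l v 0 i * w 0 j * z 0 l * D l i j).
  rewrite -big_split -sumrB; apply: eq_bigr => i _.
  under eq_bigr do rewrite mulr_suml.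
  rewrite exchange_big -big_split -sumrB; apply: eq_bigr => j _.
  rewrite -big_split -sumrB; apply: eq_bigr => l _ /=.
  by rewrite /K; ring.
rewrite exchange_big; apply: eq_bigr => i _; rewrite exchange_big.
by apply: eq_bigr => j _; apply: eq_bigr => l _; ring.
Qed.

Lemma GammaC c y v w : (chart c @` dom c) y ->
  Gamma h c y v w = Gamma h c y w v.
Proof.
move=> Uy; apply: (chart_form_inj Uy) => z.
have two0 : (2 : R) != 0 by [].
apply: (mulfI two0); rewrite (koszul v w z Uy) (koszul w v z Uy).
rewrite [X in X - _ = _]addrC; congr (_ - 'D_z _ y).
by apply/funext => x; exact: chart_form_sym.
Qed.

(** The connection is metric: adding the Koszul formulas for (u, v; w) and
    (u, w; v), all terms but the derivative along u cancel. *)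
Lemma chart_form_parallel c y u v w : (chart c @` dom c) y ->
  'D_u (fun x => chart_form c x v w) y =
  chart_form c y (Gamma h c y u v) w + chart_form c y v (Gamma h c y u w).
Proof.
move=> Uy; have two0 : (2 : R) != 0 by [].
pose D t a b := 'D_t (fun x => chart_form c x a b) y.
have K a b t : 2 * chart_form c y (Gamma h c y a b) t =
  D a b t + D b a t - D t a b := koszul a b t Uy.
have DC : D u w v = D u v w.
  by congr ('D_u _ y); apply/funext => x; exact: chart_form_sym.
rewrite -[LHS]/(D u v w) [chart_form c y v _]chart_form_sym.
clearbody D; apply: (mulfI two0).
by rewrite mulrDr (K u v w) (K u w v) DC; ring.
Qed.

Lemma chart_form_parallel_at p (u v w : tangent A p) :
  let k := chart_at A p in let y := chart k p in
  'D_u (fun x => chart_form k x v w) y =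
  h p (Gamma h k y v u) w + h p v (Gamma h k y w u).
Proof.
move=> k y; have Uy : (chart k @` dom k) y by exists p => //; exact: chart_at_dom.
rewrite (chart_form_parallel u v w Uy) !chart_form_at.
by rewrite (GammaC u v Uy) (GammaC u w Uy).
Qed.

Lemma Gamma_derivable c y u v w : (chart c @` dom c) y ->
  derivable (fun z => Gamma h c z v w) y u.
Proof.
move=> Uy; apply/derivable_mxP => i0 k.
rewrite (_ : (fun x => _) =
  fun z => \sum_i \sum_j v 0 i * w 0 j * christoffel h c z i j k); last first.
  by apply/funext => z; rewrite mxE.
apply: derivable_sumf => i; apply: derivable_sumf => j.
apply: derivableM; first exact: derivable_cst.
apply: derivableM; first exact: derivable_cst.
apply: derivable_sumf => l; apply: derivableM.
  apply: derivable_invmx.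
    by move=> ? ?; exact/diff_derivable/gram_differentiable.
  near=> z; apply: gram_unit; near: z.
  by apply: open_nbhs_nbhs; split => //; exact: open_chart.
by apply: derivableB; [apply: derivableD|];
  exact/diff_derivable/derive_gram_differentiable.
Unshelve. all: by end_near. Qed.

End Nondegenerate.
End ChartForm.

Section ConstantFields.
Variables (R : realType) (n : nat) (M : Type) (A : smoothAtlas R n M).
Variables (h : symTensor A) (c : chart_index A).
Implicit Types (y X Y Z : 'rV[R]_n).

Lemma Gamma0l y X : Gamma h c y 0 X = 0.
Proof.
apply/rowP => k; rewrite !mxE; apply: big1 => i _; apply: big1 => j _.
by rewrite !mxE !mul0r.
Qed.

Lemma curvature_field_cst X Y Z y :
  curvature_field h c (cst X) (cst Y) (cst Z) y =
  ('D_X (fun z => Gamma h c z Y Z) y + Gamma h c y X (Gamma h c y Y Z)) -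
  ('D_Y (fun z => Gamma h c z X Z) y + Gamma h c y Y (Gamma h c y X Z)).
Proof.
have nab V W : nabla h c (cst V) (cst W) = fun z => Gamma h c z V W.
  by apply/funext => z; rewrite /nabla derive_cst add0r.
have br : lie_bracket (cst X) (cst Y) = cst (0 : 'rV[R]_n).
  by apply/funext => z; rewrite /lie_bracket !derive_cst subrr.
rewrite /curvature_field br !nab !fctE /nabla.
by rewrite Gamma0l oppr0 addr0.
Qed.

End ConstantFields.

(** * Charts of the tangent bundle *)

Section TangentCharts.
Variables (R : realType) (n : nat) (M : Type) (A : smoothAtlas R n M).
Implicit Types (c d : chart_index A) (p : M) (y v X Y Z : 'rV[R]_n).
Let TA := tangentAtlas A.

Lemma tchart_coords c p v : dom c p ->
  tchart c (existT (tangent A) p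
    (coord_change c (chart_at A p) (chart c p) v)) = row_mx (chart c p) v.
Proof.
move=> cp; rewrite /tchart /= coord_changeVK //; exact: chart_at_dom.
Qed.

Lemma tchart_transition c d p v : dom c p -> dom d p ->
  (tchart d \o tparam c) (row_mx (chart c p) v) =
  row_mx (chart d p) (coord_change c d (chart c p) v).
Proof.
move=> cp dp; have kp := chart_at_dom A p.
rewrite -(tchart_coords v cp) [LHS]/(tchart d (tparam c _)) tchartK;
  last exact: cp.
by congr row_mx; exact: coord_changeK.
Qed.

Lemma coord_change_differentiable c d p v : dom c p -> dom d p ->
  differentiable (fun y => coord_change c d y v) (chart c p).
Proof.
move=> cp dp; have [_ /(_ v)[H _]] := @smooth_transition _ _ _ A c d 2.
by apply: H; exists p.
Qed.

Lemma coord_changeZ c d p (s : R) v : dom c p -> dom d p ->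
  coord_change c d (chart c p) (s *: v) = s *: coord_change c d (chart c p) v.
Proof.
move=> cp dp; have := coord_change_linear cp dp s v 0.
by rewrite coord_change0 !addr0.
Qed.

(** The coordinate vector (X, 0) of a chart of TM is not invariantly
    horizontal: changing the chart of M turns it into a vector whose vertical
    part involves the second derivative of the transition map. *)
Lemma tcoord_change_base c d p v X : dom c p -> dom d p ->
  coord_change (c : chart_index TA) (d : chart_index TA)
    (row_mx (chart c p) v) (row_mx X 0) =
  row_mx (coord_change c d (chart c p) X)
    ('D_X (fun y => coord_change c d y v) (chart c p)).
Proof.
move=> cp dp.
pose F y := row_mx ((chart d \o param c) y) (coord_change c d y v).
have dF : is_derive (chart c p) X F (row_mx (coord_change c d (chart c p) X)
    ('D_X (fun y => coord_change c d y v) (chart c p))).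
  apply: is_derive_row_mx; apply/derivableP/diff_derivable.
    exact: transition_differentiable.
  exact: coord_change_differentiable.
apply: derive_val; apply: is_derive_along dF.
have nO : \forall y \near chart c p, (chart c @` (dom c `&` dom d)) y.
  by apply: open_nbhs_nbhs; split; [exact: open_overlap|exists p].
have := near0_line X nO; apply: filterS => h [q [cq dq] E].
rewrite scale_row_mx add_row_mx scaler0 add0r -E.
rewrite [RHS](tchart_transition v cq dq); congr row_mx.
by rewrite /= chartK.
Qed.

Lemma tcoord_change_base0 c d p X : dom c p -> dom d p ->
  coord_change (c : chart_index TA) (d : chart_index TA)
    (row_mx (chart c p) 0) (row_mx X 0) =
  row_mx (coord_change c d (chart c p) X) 0.
Proof.
move=> cp dp; rewrite (tcoord_change_base 0 X cp dp); congr row_mx.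
have -> : (fun y => coord_change c d y 0) = cst 0.
  by apply/funext => z; exact: coord_change0.
exact: derive_cst.
Qed.

(** Transition maps of TM are linear on the fibres, hence equal to their own
    derivative along them. *)
Lemma tcoord_change_fiber c d p v X : dom c p -> dom d p ->
  coord_change (c : chart_index TA) (d : chart_index TA)
    (row_mx (chart c p) v) (row_mx 0 X) =
  row_mx 0 (coord_change c d (chart c p) X).
Proof.
move=> cp dp.
pose L : {linear 'rV[R]_n -> 'rV[R]_n} :=
  HB.pack (coord_change c d (chart c p))
    (GRing.isLinear.Build _ _ _ _ _ (coord_change_linear cp dp)).
have dL : is_derive v X L (L X).
  have dif : differentiable L v.
    by apply: linear_differentiable; exact: rV_linear_continuous.
  split; first exact: diff_derivable.
  by rewrite deriveE // diff_lin //; exact: rV_linear_continuous.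
apply: derive_val; apply: is_derive_along (is_derive_row_mx
  (is_derive_cst (chart d p) v X) dL).
near=> h; rewrite scale_row_mx add_row_mx scaler0 add0r.
by symmetry; exact: (tchart_transition (h *: X + v) cp dp).
Unshelve. all: by end_near. Qed.

Lemma tangent_chart_form (G : symTensor TA) c p v a b : dom c p ->
  let k := chart_at A p in let w := row_mx (chart c p) v in
  chart_form G c w a b =
  G (existT (tangent A) p (coord_change c k (chart c p) v))
    (coord_change (c : chart_index TA) (k : chart_index TA) w a)
    (coord_change (c : chart_index TA) (k : chart_index TA) w b).
Proof.
move=> cp k w; pose z : tbundle A :=
  existT (tangent A) p (coord_change c k (chart c p) v).
have -> : w = chart (c : chart_index TA) z by rewrite /w -(tchart_coords v cp).
exact: (@chart_formE _ _ _ TA G c z).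
Qed.

End TangentCharts.

(** * Natural metrics along the zero section *)

Section NaturalMetric.
Variables (R : realType) (n : nat) (M : Type) (A : smoothAtlas R n M).
Implicit Types (c d : chart_index A) (p : M) (y v X Y Z B C : 'rV[R]_n).
Let TA := tangentAtlas A.
Variables (g : symTensor A) (G : symTensor TA).
Variables (a1 a2 a3 b1 b2 b3 : R -> R).

(** [g_natural] with its coefficient functions made explicit. *)
Definition natural_with : Prop :=
    forall (p : M) (u X Y : tangent A p), let t := g p u u in
      let Gu := G (existT (tangent A) p u) in
      [/\ Gu (hlift g u X) (hlift g u Y) =
            (a1 t + a3 t) * g p X Y + (b1 t + b3 t) * g p X u * g p Y u,
          Gu (hlift g u X) (vlift u Y) =
            a2 t * g p X Y + b2 t * g p X u * g p Y u,
          Gu (vlift u X) (hlift g u Y) =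
            a2 t * g p X Y + b2 t * g p X u * g p Y u &
          Gu (vlift u X) (vlift u Y) =
            a1 t * g p X Y + b1 t * g p X u * g p Y u].

Hypothesis G_nat : natural_with.

Lemma Gamma0r c y v : Gamma g c y v 0 = 0.
Proof.
apply/rowP => k; rewrite !mxE; apply: big1 => i _; apply: big1 => j _.
by rewrite !mxE mulr0 mul0r.
Qed.

Lemma GammaZr c y v w (s : R) :
  Gamma g c y v (s *: w) = s *: Gamma g c y v w.
Proof.
apply/rowP => k; rewrite !mxE mulr_sumr; apply: eq_bigr => i _.
by rewrite mulr_sumr; apply: eq_bigr => j _; rewrite !mxE; ring.
Qed.

Lemma row_mx_lifts p (u X B : tangent A p) :
  row_mx X B = hlift g u X +
    vlift u (B + Gamma g (chart_at A p) (chart (chart_at A p) p) X u).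
Proof. by rewrite /hlift /vlift add_row_mx addr0 addrC addrK. Qed.

(** The g-natural metric on arbitrary vectors of TM: a vector with components
    (X, B) is the horizontal lift of X plus the vertical lift of
    B + Gamma (X, u). *)
Lemma natural_form p (u X Y B C : tangent A p) :
  let Gam X := Gamma g (chart_at A p) (chart (chart_at A p) p) X u in
  let t := g p u u in
  G (existT (tangent A) p u) (row_mx X B) (row_mx Y C) =
    ((a1 t + a3 t) * g p X Y + (b1 t + b3 t) * g p X u * g p Y u) +
    (a2 t * g p X (C + Gam Y) + b2 t * g p X u * g p (C + Gam Y) u) +
    (a2 t * g p (B + Gam X) Y + b2 t * g p (B + Gam X) u * g p Y u) +
    (a1 t * g p (B + Gam X) (C + Gam Y) +
     b1 t * g p (B + Gam X) u * g p (C + Gam Y) u).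
Proof.
move=> Gam t; rewrite (row_mx_lifts u X B) (row_mx_lifts u Y C).
rewrite [LHS]tensorDl [X in X + _ = _]tensorDr [X in _ + X = _]tensorDr.
have [-> _ _ _] := G_nat u X Y.
have [_ -> _ _] := G_nat u X (C + Gam Y).
have [_ _ -> _] := G_nat u (B + Gam X) Y.
have [_ _ _ ->] := G_nat u (B + Gam X) (C + Gam Y).
by rewrite !addrA.
Qed.

Hypothesis g_riem : riemannian_metric g.
Hypotheses (sa1 : smooth_nonneg a1) (sa2 : smooth_nonneg a2)
  (sa3 : smooth_nonneg a3) (sb1 : smooth_nonneg b1) (sb2 : smooth_nonneg b2)
  (sb3 : smooth_nonneg b3).

Lemma riemannian_nondegenerate : nondegenerate_metric g.
Proof.
move=> p X X0; apply/eqP/negPn/negP => /g_riem.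
by rewrite X0 ltxx.
Qed.

Lemma riemannian_ge0 p (X : tangent A p) : 0 <= g p X X.
Proof.
have [->|/g_riem/ltW //] := eqVneq X 0.
by rewrite tensor0r.
Qed.

(** Here X, Y, Z are tangent to M at p, and (X, s B), (Y, s C) are vectors of TM
    at the point s Z of the ray spanned by Z.  Their vertical parts are s FX
    and s FY. *)
Section Ray.
Variables (p : M) (X Y Z B C : tangent A p).
Let k := chart_at A p.
Let FX := B + Gamma g k (chart k p) X Z.
Let FY := C + Gamma g k (chart k p) Y Z.
Let al (a : R -> R) s := a (s ^+ 2 * g p Z Z).

(** The first-order coefficient in s of the metric along the ray, up to the
    factor alpha2(0). *)
Definition ray_slope : R := g p X FY + g p FX Y.

(** With B and C second derivatives of the transition map and D the derivative of
    g given by metric compatibility, the left-hand side is the derivative of g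
    computed in another chart. *)
Lemma ray_slope_transport (D : R) :
  D = g p (Gamma g k (chart k p) X Z) Y + g p X (Gamma g k (chart k p) Y Z) ->
  D + g p B Y + g p X C = ray_slope.
Proof. by move=> ->; rewrite /ray_slope /FX /FY tensorDr tensorDl; ring. Qed.

(** The value of G on (X, s B) and (Y, s C) as a function of s, arranged so that
    the coefficient of s is exhibited. *)
Definition ray_form : R -> R :=
  (al a1 + al a3) * cst (g p X Y) +
  id * (al a2 * cst ray_slope +
       id * ((al b1 + al b3) * cst (g p X Z * g p Y Z) +
            al a1 * cst (g p FX FY) +
            id * (al b2 * cst (g p X Z * g p FY Z + g p FX Z * g p Y Z) +
                 id * (al b1 * cst (g p FX Z * g p FY Z))))).

Lemma natural_form_ray s :
  G (existT (tangent A) p (s *: Z)) (row_mx X (s *: B)) (row_mx Y (s *: C)) =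
  ray_form s.
Proof.
rewrite natural_form !GammaZr -!scalerDr -/FX -/FY !tensorZr !tensorZl.
have -> : s * (s * g p Z Z) = s ^+ 2 * g p Z Z by ring.
rewrite /ray_form /ray_slope !fctE -/(al a1 s) -/(al a2 s) -/(al a3 s).
by rewrite -/(al b1 s) -/(al b2 s) -/(al b3 s); ring.
Qed.

Lemma is_derive_ray : is_derive (0 : R) (1 : R) ray_form (a2 0 * ray_slope).
Proof.
have q0 : 0 <= g p Z Z := riemannian_ge0 _.
have d a : smooth_nonneg a -> derivable (al a) 0 1.
  by move=> sa; have [] := smooth_nonneg_square sa q0.
have dC (r : R) : derivable (cst r : R -> R) 0 1 by exact: derivable_cst.
have := d _ sa1; have := d _ sa2; have := d _ sa3.
have := d _ sb1; have := d _ sb2; have := d _ sb3 => e3 e2 e1 d3 d2 d1.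
have a20 : a2 0 = al a2 0 by rewrite /al expr0n mul0r.
have D1 : is_derive (0 : R) (1 : R) (al a1 + al a3) 0.
  rewrite -[X in is_derive _ _ _ X]addr0.
  by apply: is_deriveD; exact: smooth_nonneg_square.
rewrite /ray_form a20.
move: ray_slope (g p X Y) (g p X Z * g p Y Z) (g p FX FY)
  (g p X Z * g p FY Z + g p FX Z * g p Y Z) (g p FX Z * g p FY Z).
move: (al a1) (al a2) (al a3) (al b1) (al b2) (al b3) d1 d2 d3 e1 e2 e3 D1.
move=> f1 f2 f3 h1 h2 h3 d1 d2 d3 e1 e2 e3 D1 r0 r1 r2 r3 r4 r5.
apply: (is_derive_first_order r1 D1).
  have dI : derivable (id : R -> R) 0 1 by exact: derivable_id.
  exact: (derivableD (derivableM d2 (dC _)) (derivableM dI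
    (derivableD (derivableD (derivableM (derivableD e1 e3) (dC _))
                            (derivableM d1 (dC _)))
      (derivableM dI (derivableD (derivableM e2 (dC _))
        (derivableM dI (derivableM e1 (dC _)))))))).
by rewrite !fctE; ring.
Qed.

End Ray.

Lemma natural_form_zero p (X Y C : tangent A p) :
  G (existT (tangent A) p 0) (row_mx X 0) (row_mx Y C) =
  (a1 0 + a3 0) * g p X Y + a2 0 * g p X C.
Proof.
rewrite natural_form !Gamma0r !addr0 !tensor0r !tensor0l.
by rewrite !(mulr0, mul0r, addr0).
Qed.

Lemma zero_section_base c y X Y : (chart c @` dom c) y ->
  chart_form G c (row_mx y 0) (row_mx X 0) (row_mx Y 0) =
  (a1 0 + a3 0) * chart_form g c y X Y.
Proof.
move=> [p cp <-]; have kp := chart_at_dom A p.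
rewrite (tangent_chart_form _ _ _ _ cp) (tcoord_change_base0 X cp kp).
rewrite (tcoord_change_base0 Y cp kp) coord_change0 natural_form_zero.
by rewrite tensor0r mulr0 addr0 (chart_formE g X Y cp).
Qed.

Lemma zero_section_mixed c y X Y : (chart c @` dom c) y ->
  chart_form G c (row_mx y 0) (row_mx X 0) (row_mx 0 Y) =
  a2 0 * chart_form g c y X Y.
Proof.
move=> [p cp <-]; have kp := chart_at_dom A p.
rewrite (tangent_chart_form _ _ _ _ cp) (tcoord_change_base0 X cp kp).
rewrite (tcoord_change_fiber 0 Y cp kp) coord_change0 natural_form_zero.
by rewrite tensor0r mulr0 add0r (chart_formE g X Y cp).
Qed.

Section AlongFibre.
Variables (c : chart_index A) (p : M) (X Y Z : 'rV[R]_n).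
Hypothesis cp : dom c p.
Let k := chart_at A p.
Let kp : dom k p := chart_at_dom A p.
Let y := chart c p.
Let T v : tangent A p := coord_change c k y v.
Let E v : tangent A p := 'D_v (fun y => coord_change c k y Z) y.
Let L := ray_slope (T X) (T Y) (T Z) (E X) (E Y).

(** Both charts c and k compute the derivative of g(X, Y) along Z: in k it
    consists of the derivative of g_k, rewritten with the Christoffel form,
    and of the derivatives of the components of X and Y, which are second
    derivatives of the transition map. *)
Lemma derive_chart_form_transport :
  'D_Z (fun z => chart_form g c z X Y) y = L.
Proof.
pose f : 'rV[R]_n -> 'rV[R]_n := chart k \o param c.
have fy : f y = chart k p by rewrite /f /y /= chartK.
have Uf : (chart k @` dom k) (f y) by rewrite fy; exists p.
have df : differentiable f y by exact: transition_differentiable.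
have nO : \forall z \near y, (chart c @` (dom c `&` dom k)) z.
  by apply: open_nbhs_nbhs; split; [exact: open_overlap|exists p].
have dT v : differentiable (fun z => coord_change c k z v) y.
  exact: coord_change_differentiable.
have comm v : 'D_Z (fun z => coord_change c k z v) y =
    'D_v (fun z => coord_change c k z Z) y.
  apply: (@derive_comm_rV _ _ _ f); [|exact: dT|exact: dT].
  by apply: filterS nO => _ [q [cq kq] <-]; exact: transition_differentiable.
have [_ D] := is_derive_chart_form_along g Uf df
  (@diff_derivable _ _ _ _ y Z (dT X)) (@diff_derivable _ _ _ _ y Z (dT Y)).
transitivity ('D_Z (fun z => chart_form g k (f z) (coord_change c k z X)
    (coord_change c k z Y)) y).
  apply: near_eq_derive; apply: filterS nO => _ [q [cq kq] <-].
  by rewrite /f /= chartK //; exact: chart_form_change.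
have P := chart_form_parallel_at riemannian_nondegenerate (T Z) (T X) (T Y).
rewrite D fy !comm !chart_form_at -/(T X) -/(T Y) -['D_Z f y]/(T Z).
exact: ray_slope_transport P.
Qed.

Lemma chart_form_along_fibre s :
  chart_form G c (row_mx y (s *: Z)) (row_mx X 0) (row_mx Y 0) =
  ray_form (T X) (T Y) (T Z) (E X) (E Y) s.
Proof.
have dZ v : 'D_v (fun y => coord_change c k y (s *: Z)) y =
    s *: 'D_v (fun y => coord_change c k y Z) y.
  rewrite -deriveZ; last first.
    by apply: diff_derivable; exact: coord_change_differentiable.
  apply: near_eq_derive.
  have nO : \forall z \near y, (chart c @` (dom c `&` dom k)) z.
    by apply: open_nbhs_nbhs; split; [exact: open_overlap|exists p].
  by apply: filterS nO => _ [r [cr kr] <-]; exact: coord_changeZ.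
rewrite (tangent_chart_form _ _ _ _ cp).
rewrite (tcoord_change_base _ X cp kp).
rewrite (tcoord_change_base _ Y cp kp).
rewrite (coord_changeZ _ _ cp kp).
apply: etrans _ (natural_form_ray _ _ _ _ _ _).
by congr (G _ (row_mx _ _) (row_mx _ _)); exact: dZ.
Qed.

(** Only the mixed part alpha2 of the metric contributes at first order. *)
Lemma is_derive_along_fibre :
  is_derive (row_mx y 0) (row_mx 0 Z)
    (fun w => chart_form G c w (row_mx X 0) (row_mx Y 0)) (a2 0 * L).
Proof.
apply: is_derive_along (is_derive_ray (T X) (T Y) (T Z) (E X) (E Y)).
near=> h.
rewrite addr0 [h *: 1]mulr1 scale_row_mx add_row_mx !scaler0 add0r addr0.
by rewrite chart_form_along_fibre.
Unshelve. all: by end_near. Qed.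

End AlongFibre.

(* Only the Koszul formula and the values of [chart_form] matter now. *)
Local Opaque chart_form Gamma.

Hypothesis G_nondeg : nondegenerate_metric G.

Lemma tangent_chart_image c y v : (chart c @` dom c) y ->
  (chart (c : chart_index TA) @` dom (c : chart_index TA)) (row_mx y v).
Proof.
move=> [p cp <-].
exists (existT (tangent A) p (coord_change c (chart_at A p) (chart c p) v)).
  exact: cp.
exact: tchart_coords.
Qed.

Lemma derive_along_zero_section c y X f h (r : R) : (chart c @` dom c) y ->
  (forall z, (chart c @` dom c) z -> f (row_mx z 0) = r * h z) ->
  derivable h y X ->
  'D_(row_mx X 0) (f : 'rV[R]_(n + n) -> R) (row_mx y 0) = r * 'D_X h y.
Proof.
move=> Uy fh dh; have dh' := is_deriveZ r (derivableP dh).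
apply: derive_val; apply: is_derive_along dh'.
have nU : \forall z \near y, (chart c @` dom c) z.
  by apply: open_nbhs_nbhs; split => //; exact: open_chart.
have := near0_line X nU; apply: filterS => s Us.
by rewrite scale_row_mx add_row_mx scaler0 addr0 fh.
Qed.

(** The zero section is totally geodesic, with the induced connection that of g.
    On a fibre vector w, the three Koszul terms for G are alpha2(0) times those
    for g, and alpha2(0) g is also the mixed part of G; likewise with
    (alpha1 + alpha3)(0) on a horizontal v. *)
Lemma Gamma_zero_section c y X Y : (chart c @` dom c) y ->
  Gamma G (c : chart_index TA) (row_mx y 0) (row_mx X 0) (row_mx Y 0) =
  row_mx (Gamma g c y X Y) 0.
Proof.
move=> Uy; have Uw := tangent_chart_image 0 Uy.
have two0 : (2 : R) != 0 by [].
have nd := riemannian_nondegenerate.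
have df v w u : derivable (fun z => chart_form g c z v w) y u.
  by have [] := is_derive_chart_form g v w u Uy.
have base u v w : 'D_(row_mx u 0)
    (fun z => chart_form G c z (row_mx v 0) (row_mx w 0)) (row_mx y 0) =
    (a1 0 + a3 0) * 'D_u (fun z => chart_form g c z v w) y.
  apply: (derive_along_zero_section Uy) => [z Uz|]; last exact: df.
  exact: zero_section_base.
have mixed u v w : 'D_(row_mx u 0)
    (fun z => chart_form G c z (row_mx v 0) (row_mx 0 w)) (row_mx y 0) =
    a2 0 * 'D_u (fun z => chart_form g c z v w) y.
  apply: (derive_along_zero_section Uy) => [z Uz|]; last exact: df.
  exact: zero_section_mixed.
have fibre w : 'D_(row_mx 0 w)
    (fun z => chart_form G c z (row_mx X 0) (row_mx Y 0)) (row_mx y 0) =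
    a2 0 * 'D_w (fun z => chart_form g c z X Y) y.
  case: Uy => p cp <-; rewrite (derive_chart_form_transport X Y w cp).
  by apply: derive_val; exact: is_derive_along_fibre.
have kos (r r' s s' t t' : R) : r = r' -> s = s' -> t = t' ->
  r + s - t = r' + s' - t' by move=> -> -> ->.
apply: (chart_form_inj G_nondeg Uw) => b.
have -> : b = row_mx (lsubmx b) 0 + row_mx 0 (rsubmx b).
  by rewrite add_row_mx addr0 add0r hsubmxK.
move: (lsubmx b) (rsubmx b) => v w.
apply: etrans (chart_formDr G _ _ _ Uw) _.
apply: etrans _ (esym (chart_formDr G _ _ _ Uw)).
apply: congr2; apply: (mulfI two0).
  apply: etrans (koszul G_nondeg _ _ _ Uw) _.
  apply: etrans (kos _ _ _ _ _ _ (base X Y v) (base Y X v) (base v X Y)) _.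
  apply: etrans _ (esym (congr1 ( *%R 2) (zero_section_base _ _ Uy))).
  by rewrite mulrCA (koszul nd X Y v Uy) mulrBr mulrDr.
apply: etrans (koszul G_nondeg _ _ _ Uw) _.
apply: etrans (kos _ _ _ _ _ _ (mixed X Y w) (mixed Y X w) (fibre w)) _.
apply: etrans _ (esym (congr1 ( *%R 2) (zero_section_mixed _ _ Uy))).
by rewrite mulrCA (koszul nd X Y w Uy) mulrBr mulrDr.
Qed.

End NaturalMetric.

(** * Curvature along the zero section *)

(** On constant horizontal fields, the derivatives and the iterated Christoffel
    forms that make up the curvature only involve [Gamma_zero_section]. *)
Lemma curvature_zero_section (R : realType) (n : nat) (M : Type)
  (A : smoothAtlas R n M) (g : symTensor A) (G : symTensor (tangentAtlas A))
  (g_riem : riemannian_metric g) (G_nat : g_natural g G)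
  (G_nondeg : nondegenerate_metric G) (p : M) (X Y Z : tangent A p) :
  curvature G (p := existT (tangent A) p 0)
    (row_mx X 0) (row_mx Y 0) (row_mx Z 0) =
  row_mx (curvature g X Y Z) 0.
Proof.
have [a1 [a2 [a3 [b1 [b2 [b3 [[sa1 sa2 sa3] [[sb1 sb2 sb3] GE]]]]]]]] := G_nat.
set k := chart_at A p; set y := chart k p.
have kp : dom k p := chart_at_dom A p.
have Uy : (chart k @` dom k) y by exists p.
have E z V W : (chart k @` dom k) z ->
    Gamma G (k : chart_index (tangentAtlas A)) (row_mx z 0)
      (row_mx V 0) (row_mx W 0) = row_mx (Gamma g k z V W) 0.
  exact: (Gamma_zero_section GE g_riem sa1 sa2 sa3 sb1 sb2 sb3 G_nondeg).
have DE U V W : 'D_(row_mx U 0) (fun w =>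
      Gamma G (k : chart_index (tangentAtlas A)) w (row_mx V 0) (row_mx W 0))
      (row_mx y 0) = row_mx ('D_U (fun z => Gamma g k z V W) y) 0.
  have dG : derivable (fun z => Gamma g k z V W) y U :=
    Gamma_derivable (riemannian_nondegenerate g_riem) Uy.
  apply: derive_val; apply: is_derive_along
    (is_derive_row_mx (derivableP dG) (is_derive_cst (0 : 'rV[R]_n) y U)).
  have nU : \forall z \near y, (chart k @` dom k) z.
    by apply: open_nbhs_nbhs; split => //; exact: open_chart.
  have := near0_line U nU; apply: filterS => s Us.
  by rewrite scale_row_mx add_row_mx scaler0 addr0 E.
have base : chart (chart_at (tangentAtlas A) (existT (tangent A) p 0))
    (existT (tangent A) p 0) = row_mx y 0.
  by rewrite /= /tchart /= coord_change0.
rewrite /curvature base (curvature_field_cst G) (curvature_field_cst g).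
rewrite (DE X) (DE Y) !(E y) // !add_row_mx opp_row_mx add_row_mx.
by rewrite !addr0 subrr.
Qed.

Theorem proposition3p1 (R : realType) (n : nat) (dim_ge2 : (2 <= n)%N)
  (M : smoothManifold R n) (g : symTensor (atlas M)) (g_riem : riemannian_metric g)
  (G : symTensor (tangentAtlas (atlas M))) (G_nat : g_natural g G)
  (G_nondeg : nondegenerate_metric G)
  (x : M) (X : tangent (atlas M) x) (X_unit : g x X X = 1) (lambda : R) :
  is_eigenvalue (jacobi g X) lambda ->
  is_eigenvalue (jacobi G (hlift g (0 : tangent (atlas M) x) X)) lambda.
Proof.
(* At a zero vector, [row_mx Y 0] is the horizontal lift of Y. *)
move=> [Y YE Y0]; exists (row_mx Y 0).
  rewrite /hlift Gamma0r oppr0 /jacobi (curvature_zero_section g_riem G_nat) //.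
  by rewrite -/(jacobi g X Y) YE scale_row_mx scaler0.
by rewrite row_mx_eq0 negb_and Y0.
Qed.
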